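(* There exists $C>0$ such that for every odd integer $k>C$ there exists a probability measure $\sigma_k$ on $[0,1]$, absolutely continuous with density essentially bounded above by $Ck$, satisfying $$n^0_{\sigma_k}(k)\ge\frac{1}{2\sqrt{k}}\left(\frac{e}{2}\right)^k.$$
   Context: For a probability measure $\sigma$ on $\mathbb{R}$, $n^0_\sigma(k)$ is the minimal $n$ for which there exist points $x_1,\dots,x_n\in\mathbb{R}$ (not necessarily distinct) with $\int x^j d\sigma(x)=\frac1n\sum_{i=1}^n x_i^j$ for all integers $0\le j\le k$, and $n^0_\sigma(k)=\infty$ if no such $n$ exists. *)

(* Defs.v *)
From HB Require Import structures.
From mathcomp Require Import all_boot all_order all_algebra.
From mathcomp Require Import all_classical all_reals all_analysis.

Set Implicit Arguments.
Unset Strict Implicit.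
Unset Printing Implicit Defensive.

Import Order.TTheory GRing.Theory Num.Theory.
Import numFieldNormedType.Exports.

Local Open Scope classical_set_scope.
Local Open Scope ring_scope.

(* The integral is extended-real valued; its value is finite only if
   [fun t => t ^+ j] is sigma-integrable, so this equality also asserts the
   existence of the moments up to order k. *)
Definition chebyshev_quadrature (R : realType)
    (sigma : probability (measurableTypeR R) R) (k n : nat)
    (x : 'I_n -> R) : Prop :=
  forall j : nat, (j <= k)%N ->
    (\int[sigma]_t (t ^+ j)%:E)%E = (n%:R^-1 * \sum_(i < n) x i ^+ j)%:E.

(* The minimal n, valued in the extended reals so that the infimum of the empty
   set is +oo; a nonempty set of naturals attains its infimum. *)
Definition n0 (R : realType) (sigma : probability (measurableTypeR R) R)
    (k : nat) : \bar R :=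
  ereal_inf [set n%:R%:E | n in
    [set n : nat | (0 < n)%N /\
       exists x : 'I_n -> R, chebyshev_quadrature sigma k x]].

Definition is_density (R : realType)
    (sigma : probability (measurableTypeR R) R) (f : R -> R) : Prop :=
  [/\ measurable_fun setT f,
      forall x, 0 <= f x &
      forall A : set (measurableTypeR R), measurable A ->
        sigma A = (\int[@lebesgue_measure R]_(x in A) (f x)%:E)%E].

(* Main.v *)
(** Write [k = j + 1] with [j] even, and let [sigma] put mass [2^-k] uniformly on
    [[7/8, 1]] and the remaining mass uniformly on [[0, 1/8]].  Although tiny,
    the upper block dominates both the [j]-th and the [k]-th moments, because
    [1/8 < 1/2 * 7/8]; hence the [k]-th moment exceeds [3/4] times the [j]-th.
    As [j] is even, a quadrature all of whose nodes were below [3/4] would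
    contradict this, so some node is at least [3/4], and it alone contributes
    [(3/4)^j / n] to the [j]-th moment, which is at most [2 * 2^-k].  Therefore
    [n >= (3/2)^j], and [e <= 3] concludes. *)

Require Import Defs.
From HB Require Import structures.
From mathcomp Require Import all_boot all_order all_algebra.
From mathcomp Require Import all_classical all_reals all_analysis.
From mathcomp Require Import measurable_realfun ring lra.

Set Implicit Arguments.
Unset Strict Implicit.
Unset Printing Implicit Defensive.

Import Order.TTheory GRing.Theory Num.Theory.
Import numFieldNormedType.Exports.

Local Open Scope classical_set_scope.
Local Open Scope ring_scope.

(** * Two elementary inequalities *)

(** Applying [1 + x <= expR x] at [x = -1/6] gives [e <= (6/5)^6 < 2.99]; with fifths in place of
    sixths, the same argument would only give [(5/4)^5 > 3]. *)
Lemma expR1_le3 (R : realType) : expR 1 <= 3 :> R.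
Proof.
have h : 5 / 6 <= expR (- (1 / 6)) :> R.
  by apply: le_trans (expR_ge1Dx _); lra.
have -> : 1 = 6%:R * (1 / 6) :> R by field.
rewrite expRM_natl -[1 / 6]opprK expRN exprVn.
apply: (@le_trans _ _ ((5 / 6) ^+ 6)^-1); last by rewrite -exprVn invf_div; lra.
rewrite lef_pV2 ?posrE ?exprn_gt0 ?expR_gt0 ?divr_gt0//.
by rewrite lerXn2r ?nnegrE ?expR_ge0//; lra.
Qed.

(** If every node were below [c], multiplying [x i < c] by [x i ^+ j] and summing would contradict
    the hypothesis. Evenness of [j] makes these weights nonnegative even at negative nodes, and lets
    a single node [x i >= c] bound the whole sum from below. *)
Lemma power_sum_ge (R : realFieldType) (n j : nat) (x : 'I_n -> R) (c : R) :
  0 <= c -> ~~ odd j ->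
  c * (\sum_(i < n) x i ^+ j) < \sum_(i < n) x i ^+ j.+1 ->
  c ^+ j <= \sum_(i < n) x i ^+ j.
Proof.
move=> c0 ej; have xj i : 0 <= x i ^+ j by exact: exprn_even_ge0.
case: (boolP [exists i, c <= x i]) => [/existsP[i cxi] _|/existsPn xc].
  rewrite (bigD1 i)//= -[leLHS]addr0 lerD ?sumr_ge0//.
  by rewrite lerXn2r ?nnegrE// (le_trans c0).
rewrite ltNge mulr_sumr ler_sum// => i _.
by rewrite exprS ler_wpM2r// ltW// ltNge.
Qed.

(** * Measures uniform on two blocks *)

Lemma two_block_probability (R : realType) (u v : R)
    (D E : set (measurableTypeR R)) : 0 <= u -> 0 <= v ->
  measurable D -> measurable E ->
  (u%:E * @lebesgue_measure R D + v%:E * @lebesgue_measure R E = 1)%E ->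
  exists sigma : probability (measurableTypeR R) R, forall X, sigma X =
    (u%:E * @lebesgue_measure R (X `&` D) +
     v%:E * @lebesgue_measure R (X `&` E))%E.
Proof.
move=> u0 v0 mD mE uv1.
pose mu : {measure set (measurableTypeR R) -> \bar R} :=
  measure_add (mscale (NngNum u0) (mrestr (@lebesgue_measure R) mD))
  (mscale (NngNum v0) (mrestr (@lebesgue_measure R) mE)).
have muE X : mu X = (u%:E * @lebesgue_measure R (X `&` D) +
     v%:E * @lebesgue_measure R (X `&` E))%E by exact: measure_addE.
have mu1 : mu setT = 1%E by rewrite muE !setTI.
pose P := Measure_isProbability.Build _ _ _ mu mu1.
pose sigma : probability (measurableTypeR R) R := HB.pack (Measure.sort mu) P.
by exists sigma => X; rewrite -muE.
Qed.

Lemma two_block_density (R : realType) (u v : R)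
    (D E : set (measurableTypeR R)) (sigma : probability (measurableTypeR R) R) :
  0 <= u -> 0 <= v -> measurable D -> measurable E ->
  (forall X, sigma X = (u%:E * @lebesgue_measure R (X `&` D) +
     v%:E * @lebesgue_measure R (X `&` E))%E) ->
  is_density sigma (fun x => u * \1_D x + v * \1_E x).
Proof.
move=> u0 v0 mD mE sigmaE.
have mF (w : R) F : measurable F ->
    measurable_fun setT (fun x : measurableTypeR R => w * \1_F x).
  by move=> mF; apply: measurable_funM => //; exact: measurable_indic.
split.
- by apply: measurable_funD; exact: mF.
- by move=> x; rewrite addr_ge0// mulr_ge0.
- move=> A mA; rewrite sigmaE.
  under eq_integral do rewrite EFinD.
  have integral_block (w : R) F : 0 <= w -> measurable F ->
      (\int[@lebesgue_measure R]_(x in A) (w * \1_F x)%:E =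
       w%:E * @lebesgue_measure R (A `&` F))%E.
    move=> w0 mF'; under eq_integral do rewrite EFinM.
    rewrite ge0_integralZl_EFin//.
    + by rewrite integral_indic// setIC.
    + by apply/measurable_EFinP/measurable_funTS; exact: measurable_indic.
  rewrite ge0_integralD//.
  + by rewrite !integral_block.
  + by move=> x _; rewrite lee_fin mulr_ge0.
  + by apply/measurable_EFinP/measurable_funTS; exact: mF.
  + by move=> x _; rewrite lee_fin mulr_ge0.
  + by apply/measurable_EFinP/measurable_funTS; exact: mF.
Qed.

Lemma two_block_dominates (R : realType) (u v : R)
    (D E : set (measurableTypeR R)) (sigma : probability (measurableTypeR R) R) :
  measurable D -> measurable E ->
  (forall X, sigma X = (u%:E * @lebesgue_measure R (X `&` D) +
     v%:E * @lebesgue_measure R (X `&` E))%E) ->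
  sigma `<< @lebesgue_measure R.
Proof.
move=> mD mE sigmaE.
apply/null_content_dominatesP => A mA A0.
have AI F : measurable F -> lebesgue_measure (A `&` F) = 0%E.
  move=> mF; apply: (subset_measure0 _ _ _ A0) => //.
  exact: measurableI.
by rewrite sigmaE !AI// !mule0 adde0.
Qed.

(** * Power integrals over the blocks *)

Section power_moments.
Local Open Scope ereal_scope.
Variables (R : realType) (mu : {measure set (measurableTypeR R) -> \bar R}).

Lemma measurable_pow (D : set (measurableTypeR R)) (j : nat) :
  measurable_fun D (fun t : measurableTypeR R => (t ^+ j)%:E).
Proof. by apply/measurable_EFinP/measurable_funTS; exact: exprn_measurable. Qed.

Lemma integral_two_block (D E : set (measurableTypeR R)) (f : R -> \bar R) :
  measurable D -> measurable E -> D `&` E = set0 ->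
  measurable_fun setT (f : measurableTypeR R -> \bar R) ->
  mu (~` (D `|` E)) = 0 ->
  \int[mu]_t f t = \int[mu]_(t in D) f t + \int[mu]_(t in E) f t.
Proof.
move=> mD mE DE mf DE0.
have mDE : measurable (D `|` E) by exact: measurableU.
rewrite -(setUv (D `|` E)) integral_setU//.
- rewrite integral_setU//; last 2 first.
  + exact: measurable_funTS.
  + by rewrite disj_set2E DE.
  rewrite [X in _ + X]null_set_integral ?adde0//; first exact: measurableC.
  exact: measurable_funTS.
- exact: measurableC.
- by rewrite setUv.
- by rewrite disj_set2E setICr.
Qed.

Lemma integral_pow_itv_ge (a b : R) (j : nat) : (0 <= a)%R ->
  (a ^+ j)%:E * mu `[a, b]%classic <= \int[mu]_(t in `[a, b]) (t ^+ j)%:E.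
Proof.
move=> a0; rewrite -integral_cst//; apply: ge0_le_integral => //.
- by move=> t _; rewrite lee_fin exprn_ge0.
- exact: measurable_pow.
- move=> t; rewrite /= in_itv/= => /andP[at_ _].
  by rewrite lee_fin lerXn2r// nnegrE// (le_trans a0).
Qed.

Lemma integral_pow_itv_le (a b : R) (j : nat) : (0 <= a)%R ->
  \int[mu]_(t in `[a, b]) (t ^+ j)%:E <= (b ^+ j)%:E * mu `[a, b]%classic.
Proof.
move=> a0; rewrite -integral_cst//; apply: ge0_le_integral => //.
- move=> t; rewrite /= in_itv/= => /andP[at_ _].
  by rewrite lee_fin exprn_ge0// (le_trans a0).
- exact: measurable_pow.
- move=> t; rewrite /= in_itv/= => /andP[/(le_trans a0) t0 tb].
  by rewrite lee_fin lerXn2r// nnegrE// (le_trans t0).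
Qed.

(** On [[a, b]] one has [t ^+ j.+1 = t * t ^+ j >= a * t ^+ j]. With [a = 7/8] this compares the
    contributions of the upper block to two consecutive moments. *)
Lemma integral_powS_itv_ge (a b : R) (j : nat) : (0 <= a)%R ->
  a%:E * \int[mu]_(t in `[a, b]) (t ^+ j)%:E <=
  \int[mu]_(t in `[a, b]) (t ^+ j.+1)%:E.
Proof.
move=> a0; have t0 t (i : nat) : `[a, b]%classic t -> (0 <= t ^+ i)%R.
  rewrite /= in_itv/= => /andP[at_ _].
  by rewrite exprn_ge0// (le_trans a0).
rewrite -ge0_integralZl_EFin//; first apply: ge0_le_integral => //.
- by move=> t abt; rewrite -EFinM lee_fin mulr_ge0// t0.
- by apply: emeasurable_funM => //; exact: measurable_pow.
- exact: measurable_pow.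
- move=> t abt; rewrite -EFinM lee_fin exprS ler_wpM2r ?t0//.
  by move: abt; rewrite /= in_itv/= => /andP[].
- by move=> t /t0; rewrite lee_fin.
- exact: measurable_pow.
Qed.

End power_moments.

(** * Lower bound for the number of nodes *)

(** The real arithmetic of the argument: [b] and [a] stand for the contributions of the lower and
    upper blocks to the moment of order [j]. *)
Lemma quadrature_size_ge (R : realFieldType) (n j : nat) (x : 'I_n -> R) (a b : R) :
  (0 < n)%N -> ~~ odd j -> (2 <= j)%N ->
  b <= (1/8) ^+ j ->
  (7/8) ^+ j * 2^-1 ^+ j.+1 <= a -> a <= 2^-1 ^+ j.+1 ->
  n%:R^-1 * (\sum_(i < n) x i ^+ j) = b + a ->
  7/8 * a <= n%:R^-1 * (\sum_(i < n) x i ^+ j.+1) ->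
  (3/2) ^+ j <= n%:R :> R.
Proof.
move=> n0 ej j2; set e : R := 2^-1 ^+ j.+1; set p : R := (1/8) ^+ j.
move=> b_le a_ge a_le mj mSj.
have np : 0 < n%:R :> R by rewrite ltr0n.
have p0 : 0 < p by rewrite exprn_gt0//; lra.
have pow_ge (c : R) : 1 <= c -> c ^+ 2 <= c ^+ j by move=> c1; exact: ler_weXn2l.
(* The factor 6 is what [3/4 * (b + a) < 7/8 * a] requires. The ratio of the two sides without it is
   [(7/2)^j / 2], which for [j >= 2] is at least [49/8 > 6]. *)
have a_gt : 6 * p < (7/8) ^+ j * e.
  have -> : (7/8) ^+ j * e = p * (7/2) ^+ j / 2 :> R.
    by rewrite /e exprSr mulrA -!exprMn; congr (_ ^+ _ / _); field.
  have : (7/2) ^+ 2 <= (7/2) ^+ j :> R by apply: pow_ge; lra.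
  rewrite -(ler_pM2l p0); lra.
(* Hence the moment [b + a] is at most [2 * e], that is, [2^-j]. *)
have p_le : p <= e.
  have -> : e = p * 4 ^+ j / 2 :> R.
    by rewrite /e exprSr -!exprMn; congr (_ ^+ _ / _); field.
  have : 4 ^+ 2 <= 4 ^+ j :> R by apply: pow_ge; lra.
  rewrite -(ler_pM2l p0); lra.
have : (3/4) ^+ j <= \sum_(i < n) x i ^+ j.
  apply: power_sum_ge => //.
  rewrite -(ltr_pM2l (_ : 0 < n%:R^-1)) ?invr_gt0// mulrCA mj.
  by apply: lt_le_trans mSj; lra.
rewrite -(ler_pM2l (_ : 0 < n%:R^-1)) ?invr_gt0// mj => n_ge.
have {}n_ge : n%:R^-1 * (3/4) ^+ j <= 2 * e by lra.
have eE : 2 * e = 2^-1 ^+ j by rewrite /e exprS mulrA divff// mul1r.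
have -> : 3/2 = 3/4 * 2 :> R by field.
rewrite exprMn -ler_pdivlMr ?exprn_gt0//.
by move: n_ge; rewrite eE exprVn ler_pdivrMl.
Qed.

(** Only the support and the mass of the upper block enter. Every admissible [n] is bounded from
    below, so the case where none exists, with value [+oo], is covered too. *)
Lemma n0_ge_of_blocks (R : realType) (sigma : probability (measurableTypeR R) R) (j : nat) :
  ~~ odd j -> (2 <= j)%N ->
  sigma (~` (`[0, 1/8] `|` `[7/8, 1])%classic) = 0%E ->
  sigma `[7/8, 1]%classic = (2^-1 ^+ j.+1)%:E ->
  (((3/2) ^+ j)%:E <= n0 sigma j.+1)%E.
Proof.
move=> ej j2; have ge0_78 : 0 <= 7/8 :> R by lra.
set D := `[(0:R), 1/8]%classic; set E := `[(7/8:R), 1]%classic.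
have DE : D `&` E = set0.
  apply/seteqP; split => t //.
  by rewrite /D /E/= !in_itv/= => -[/andP[_ t1] /andP[t2 _]]; lra.
move=> sigma0 sigmaE.
pose m i : \bar R := (\int[sigma]_t (t ^+ i)%:E)%E.
pose a i : \bar R := (\int[sigma]_(t in E) (t ^+ i)%:E)%E.
pose b i : \bar R := (\int[sigma]_(t in D) (t ^+ i)%:E)%E.
have mE i : m i = (b i + a i)%E.
  apply: integral_two_block => //; try exact: measurable_itv.
  exact: measurable_pow.
have b_ge0 i : (0 <= b i)%E.
  apply: integral_ge0 => t; rewrite /D/= in_itv/= lee_fin => /andP[t0 _].
  exact: exprn_ge0.
have b_le : (b j <= ((1/8) ^+ j)%:E)%E.
  apply: le_trans (integral_pow_itv_le _ _ _ _) _ => //.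
  rewrite -[leRHS]mule1 lee_wpmul2l ?lee_fin ?exprn_ge0 ?divr_ge0//.
  by apply: probability_le1; exact: measurable_itv.
have a_ge : (((7/8) ^+ j * 2^-1 ^+ j.+1)%:E <= a j)%E.
  by rewrite EFinM -sigmaE integral_pow_itv_ge.
have a_le : (a j <= (2^-1 ^+ j.+1)%:E)%E.
  rewrite -sigmaE; apply: le_trans (integral_pow_itv_le _ _ _ _) _ => //.
  by rewrite expr1n mul1e.
have aS_ge : ((7/8)%:E * a j <= a j.+1)%E by exact: integral_powS_itv_ge.
(* Both contributions are finite, so [fine] loses nothing and the comparison can be made in [R]. *)
have bjE : b j = (fine (b j))%:E.
  by rewrite fineK// ge0_fin_numE// (le_lt_trans b_le)// ltry.
have ajE : a j = (fine (a j))%:E.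
  rewrite fineK// ge0_fin_numE ?(le_lt_trans a_le) ?ltry//.
  by rewrite (le_trans _ a_ge)// lee_fin mulr_ge0 ?exprn_ge0 ?invr_ge0.
apply: le_ereal_inf_tmp => _ [n [n0 [x qx]] <-].
rewrite lee_fin.
apply: (@quadrature_size_ge _ n j x (fine (a j)) (fine (b j))) => //.
- by rewrite -lee_fin -bjE.
- by rewrite -lee_fin -ajE.
- by rewrite -lee_fin -ajE.
- by apply: EFin_inj; rewrite -qx// -[LHS]/(m j) mE EFinD -bjE -ajE.
(* In the moment of order [j.+1] the lower block is dropped, its contribution being nonnegative. *)
- rewrite -lee_fin -qx// -[leRHS]/(m j.+1) mE EFinM -ajE.
  by apply: le_trans aS_ge _; rewrite leeDr.
Qed.

Theorem corollary1p9 (R : realType) :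
  exists C : R, 0 < C /\
    forall k : nat, odd k -> C < k%:R ->
      exists sigma : probability (measurableTypeR R) R,
        [/\ sigma `[0, 1]%classic = 1%E,
            sigma `<< @lebesgue_measure R,
            exists f : R -> R, is_density sigma f /\
              {ae @lebesgue_measure R, forall x, f x <= C * k%:R} &
            (((2 * Num.sqrt k%:R)^-1 * (expR 1 / 2) ^+ k)%:E
              <= n0 sigma k)%E].
Proof.
(* Blocks of length [1/8] carrying total mass 1 have density at most 8, hence at most [8 * k]. The
   condition [k > 8] also yields [j >= 2]. *)
exists 8; split => // k ok k8.
have k3 : (2 < k)%N by rewrite -(ltr_nat R); lra.
case: k ok k8 k3 => // j ej k8 j2.
pose e : R := 2^-1 ^+ j.+1.
have e0 : 0 < e by rewrite exprn_gt0// invr_gt0.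
have e1 : e <= 1 by rewrite exprn_ile1//; lra.
pose D : set (measurableTypeR R) := `[(0:R), 1/8]%classic.
pose E : set (measurableTypeR R) := `[(7/8:R), 1]%classic.
have mD : measurable D by exact: measurable_itv.
have mE : measurable E by exact: measurable_itv.
have lD : lebesgue_measure D = (1/8)%:E.
  by rewrite lebesgue_measure_itv/= lte_fin ifT; [rewrite -EFinD subr0|lra].
have lE : lebesgue_measure E = (1/8)%:E.
  rewrite lebesgue_measure_itv/= lte_fin ifT; [rewrite -EFinD; congr EFin|]; lra.
have u0 : 0 <= 8 * (1 - e) by lra.
have v0 : 0 <= 8 * e by lra.
(* The booleans stand for membership in the two blocks; even with both true the sum is exactly 8, so
   disjointness is not invoked. *)
have f_le8 (p q : bool) : 8 * (1 - e) * p%:R + 8 * e * q%:R <= 8.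
  by case: p; case: q => /=; lra.
have uv1 : ((8 * (1 - e))%:E * lebesgue_measure D +
            (8 * e)%:E * lebesgue_measure E = 1)%E.
  by rewrite lD lE -!EFinM -EFinD; congr EFin; field.
have [sigma sigmaE] := two_block_probability u0 v0 mD mE uv1.
have DE0 : E `&` D = set0.
  apply/seteqP; split => t //; rewrite /D /E/= !in_itv/=.
  by move=> [/andP[t1 _] /andP[_ t2]]; lra.
exists sigma; split.
- rewrite sigmaE !setIidr// => t; rewrite /D /E/= !in_itv/= => /andP[t1 t2];
    apply/andP; split; lra.
- exact: two_block_dominates sigmaE.
- exists (fun x => 8 * (1 - e) * \1_D x + 8 * e * \1_E x); split.
    exact: two_block_density.
  apply: aeW => x; apply: (@le_trans _ _ 8); last by rewrite ler_peMr// ler1n.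
  rewrite !indicE.
  exact: f_le8.
- apply: le_trans (n0_ge_of_blocks _ _ _ _); rewrite ?lee_fin//.
  + rewrite mulrC ler_pdivrMr ?mulr_gt0 ?sqrtr_gt0//.
    (* The bound on [n0] has exponent [j = k - 1]; the missing factor [3/2] is absorbed by
       [2 * sqrt k >= 2]. *)
    apply: (@le_trans _ _ ((3/2) ^+ j.+1)).
      rewrite lerXn2r ?nnegrE ?divr_ge0 ?expR_ge0// ler_pM2r ?invr_gt0//.
      exact: expR1_le3.
    rewrite exprSr ler_wpM2l ?exprn_ge0//.
    have : 1 <= Num.sqrt (j.+1%:R : R) by rewrite -[leLHS]sqrtr1 ler_wsqrtr// ler1n.
    by lra.
  + by rewrite sigmaE -/D -/E setCU setIAC setICl set0I -setIA setICl
      setI0 measure0 !mule0 adde0.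
  + by rewrite sigmaE -/D -/E setIid DE0 lE measure0 mule0 add0e -EFinM;
      congr EFin; rewrite -/e; field.
Qed.
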